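(* Let $\mathcal{Q}$ be a small quantaloid and let $\mathbb{A}$ be a regular $\mathcal{Q}$-semicategory. Let $\mathcal{P}\mathbb{A}$ be the $\mathcal{Q}$-category of contravariant presheaves on $\mathbb{A}$, and let $\mathcal{R}\mathbb{A}$ and $\mathcal{Y}\mathbb{A}$ be its full subcategories of regular, respectively Yoneda, presheaves. The functors $$i\colon\mathcal{R}\mathbb{A}\to\mathcal{P}\mathbb{A},\ \phi\mapsto\phi,\qquad j\colon\mathcal{P}\mathbb{A}\to\mathcal{R}\mathbb{A},\ \psi\mapsto\mathbb{A}\otimes\psi,\qquad k\colon\mathcal{R}\mathbb{A}\to\mathcal{P}\mathbb{A},\ \theta\mapsto[\mathbb{A},\theta]$$ constitute adjunctions $i\dashv j\dashv k$ in $\mathsf{Cat}(\mathcal{Q})$. Moreover, $i$ and $k$ are fully faithful, and the image of $k$ is precisely $\mathcal{Y}\mathbb{A}$.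
   Context: A quantaloid is a category whose hom-sets are complete lattices and whose composition preserves arbitrary suprema in each variable. For arrows $g\colon Y\to Z$ and $f\colon X\to Z$ in a quantaloid, the lifting $[g,f]\colon X\to Y$ is the largest $h\colon X\to Y$ with $g\circ h\leq f$. A $\mathcal{Q}$-semicategory $\mathbb{A}$ consists of a set $\mathbb{A}_0$ of objects, each $a\in\mathbb{A}_0$ having a type $ta$, an object of $\mathcal{Q}$, and $\mathcal{Q}$-arrows $\mathbb{A}(a',a)\colon ta\to ta'$ for all $a,a'\in\mathbb{A}_0$, such that $\mathbb{A}(a'',a')\circ\mathbb{A}(a',a)\leq\mathbb{A}(a'',a)$. It is a $\mathcal{Q}$-category if moreover $1_{ta}\leq\mathbb{A}(a,a)$ for all $a$. A functor $F\colon\mathbb{C}\to\mathbb{D}$ of $\mathcal{Q}$-categories is a type-preserving map $\mathbb{C}_0\to\mathbb{D}_0$ with $\mathbb{C}(c',c)\leq\mathbb{D}(Fc',Fc)$; it is fully faithful if equality always holds. $\mathsf{Cat}(\mathcal{Q})$ is the locally preordered 2-category of $\mathcal{Q}$-categories and functors, where, for $F,G\colon\mathbb{C}\to\mathbb{D}$, $F\leq G$ iff $1_{tc}\leq\mathbb{D}(Fc,Gc)$ for all $c$. An adjunction $F\dashv G$ (with $F\colon\mathbb{C}\to\mathbb{D}$, $G\colon\mathbb{D}\to\mathbb{C}$) in $\mathsf{Cat}(\mathcal{Q})$ amounts to $\mathbb{D}(Fc,d)=\mathbb{C}(c,Gd)$ for all $c,d$. A contravariant presheaf $\phi$ of type $X$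 (an object of $\mathcal{Q}$) on a $\mathcal{Q}$-semicategory $\mathbb{A}$ is a family of $\mathcal{Q}$-arrows $\phi(a)\colon X\to ta$ ($a\in\mathbb{A}_0$) with $\mathbb{A}(a,a')\circ\phi(a')\leq\phi(a)$ for all $a,a'$. These presheaves are the objects of the $\mathcal{Q}$-category $\mathcal{P}\mathbb{A}$, with hom-arrows $\mathcal{P}\mathbb{A}(\psi,\phi)=\bigwedge_{a\in\mathbb{A}_0}[\psi(a),\phi(a)]$ (for $\phi$ of type $X$ and $\psi$ of type $Y$ this is an arrow $X\to Y$). The representable presheaf on $a\in\mathbb{A}_0$ is $Y_{\mathbb{A}}a=\mathbb{A}(-,a)$, of type $ta$. For a presheaf $\phi$ on $\mathbb{A}$, $\mathbb{A}\otimes\phi$ and $[\mathbb{A},\phi]$ are the presheaves given by $(\mathbb{A}\otimes\phi)(a)=\bigvee_{x\in\mathbb{A}_0}\mathbb{A}(a,x)\circ\phi(x)$ and $[\mathbb{A},\phi](a)=\bigwedge_{x\in\mathbb{A}_0}[\mathbb{A}(x,a),\phi(x)]$. The presheaf $\phi$ is regular if $\phi=\mathbb{A}\otimes\phi$, and Yoneda if $\phi=[\mathbb{A},\phi]$, i.e. $\phi(a)=\mathcal{P}\mathbb{A}(Y_{\mathbb{A}}a,\phi)$ for all $a$. The full subcategories of $\mathcal{P}\mathbb{A}$ on the regular and on the Yoneda presheaves are $\mathcal{R}\mathbb{A}$ and $\mathcal{Y}\mathbb{A}$. The $\mathcal{Q}$-semicategory $\mathbb{A}$ is regular if all representable presheaves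 on it are regular, i.e. $\mathbb{A}(a',a)=\bigvee_{x\in\mathbb{A}_0}\mathbb{A}(a',x)\circ\mathbb{A}(x,a)$ for all $a,a'$. *)

(* Defs.v *)
From Stdlib Require Import FunctionalExtensionality ProofIrrelevance Setoid.

Set Implicit Arguments.
Unset Strict Implicit.

Record complete_lattice := CompleteLattice {
  carrier :> Type;
  le : carrier -> carrier -> Prop;
  sup : (carrier -> Prop) -> carrier;
  inf : (carrier -> Prop) -> carrier;
  le_refl : forall u, le u u;
  le_trans : forall u v w, le u v -> le v w -> le u w;
  le_antisym : forall u v, le u v -> le v u -> u = v;
  sup_upper : forall (S : carrier -> Prop) u, S u -> le u (sup S);
  sup_least : forall (S : carrier -> Prop) v, (forall u, S u -> le u v) -> le (sup S) v;
  inf_lower : forall (S : carrier -> Prop) u, S u -> le (inf S) u;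
  inf_greatest : forall (S : carrier -> Prop) v, (forall u, S u -> le v u) -> le v (inf S) }.

Declare Scope quantaloid_scope.
Delimit Scope quantaloid_scope with Q.
Open Scope quantaloid_scope.

Infix "<=" := le : quantaloid_scope.

Record quantaloid := Quantaloid {
  qob :> Type;
  qhom : qob -> qob -> complete_lattice;
  qcomp : forall X Y Z, qhom Y Z -> qhom X Y -> qhom X Z;
  qid : forall X, qhom X X;
  qcompA : forall W X Y Z (h : qhom Y Z) (g : qhom X Y) (f : qhom W X),
    qcomp h (qcomp g f) = qcomp (qcomp h g) f;
  qcomp_idl : forall X Y (f : qhom X Y), qcomp (qid Y) f = f;
  qcomp_idr : forall X Y (f : qhom X Y), qcomp f (qid X) = f;
  qcomp_supl : forall X Y Z (S : qhom Y Z -> Prop) (f : qhom X Y),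
    qcomp (sup S) f = sup (fun h => exists2 g, S g & h = qcomp g f);
  qcomp_supr : forall X Y Z (g : qhom Y Z) (S : qhom X Y -> Prop),
    qcomp g (sup S) = sup (fun h => exists2 f, S f & h = qcomp g f) }.

Arguments qhom {_} X Y.
Arguments qid {_} X.

Infix "∘" := qcomp (at level 40, left associativity) : quantaloid_scope.

Section Lifting.
Context {Q : quantaloid}.
Implicit Types X Y Z : Q.

Lemma qcomp_monol X Y Z (g g' : qhom Y Z) (f : qhom X Y) :
  g <= g' -> g ∘ f <= g' ∘ f.
Proof.
  intros H.
  assert (E : g' = sup (fun u => u = g \/ u = g')).
  { apply le_antisym; [ apply sup_upper; now right |].
    apply sup_least; intros u [-> | ->]; [ exact H | apply le_refl ]. }
  rewrite E, qcomp_supl. apply sup_upper. exists g; [ now left | reflexivity ].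
Qed.

Lemma qcomp_monor X Y Z (g : qhom Y Z) (f f' : qhom X Y) :
  f <= f' -> g ∘ f <= g ∘ f'.
Proof.
  intros H.
  assert (E : f' = sup (fun u => u = f \/ u = f')).
  { apply le_antisym; [ apply sup_upper; now right |].
    apply sup_least; intros u [-> | ->]; [ exact H | apply le_refl ]. }
  rewrite E, qcomp_supr. apply sup_upper. exists f; [ now left | reflexivity ].
Qed.

Definition lifting X Y Z (g : qhom Y Z) (f : qhom X Z) : qhom X Y :=
  sup (fun h => g ∘ h <= f).

Lemma liftingP X Y Z (g : qhom Y Z) (f : qhom X Z) (h : qhom X Y) :
  h <= lifting g f <-> g ∘ h <= f.
Proof.
  split; intros H; [| now apply sup_upper ].
  apply le_trans with (g ∘ lifting g f); [ now apply qcomp_monor |].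
  unfold lifting; rewrite qcomp_supr.
  apply sup_least; intros u [k Hk ->]; exact Hk.
Qed.

End Lifting.

(* The objects are presented fibrewise over their types: [A X] is the set of
   objects of type [X], so that the whole set of objects is [{X : Q & A X}].
   The arrow written A(a', a) : ta -> ta' is [shom a' a]. *)
Record semicategory (Q : quantaloid) := Semicategory {
  sob :> Q -> Type;
  shom : forall (X' X : Q), sob X' -> sob X -> qhom X X';
  scomp : forall (X'' X' X : Q) (a'' : sob X'') (a' : sob X') (a : sob X),
    shom a'' a' ∘ shom a' a <= shom a'' a }.

Arguments shom {Q} s {X' X} a' a.

Record category (Q : quantaloid) := Category {
  csemi :> semicategory Q;
  cunit : forall (X : Q) (a : csemi X), qid X <= shom csemi a a }.

(* Preservation of types is built into the fibrewise presentation. *)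
Record functor (Q : quantaloid) (C D : category Q) := Functor {
  fob :> forall X : Q, C X -> D X;
  fhom : forall (X' X : Q) (c' : C X') (c : C X),
    shom C c' c <= shom D (fob c') (fob c) }.

Arguments fob {Q C D} f {X} c.

Section Functors.
Context {Q : quantaloid}.

Definition fully_faithful (C D : category Q) (F : functor C D) : Prop :=
  forall (X' X : Q) (c' : C X') (c : C X), shom C c' c = shom D (F _ c') (F _ c).

Definition functor_id (C : category Q) : functor C C :=
  {| fob := fun X c => c;
     fhom := fun X' X c' c => le_refl (shom C c' c) |}.

Definition functor_comp (C D E : category Q) (G : functor D E) (F : functor C D) :
  functor C E :=
  {| fob := fun X c => G X (F X c);
     fhom := fun X' X c' c => le_trans (fhom F c' c) (fhom G (F X' c') (F X c)) |}.

Definition functor_le (C D : category Q) (F G : functor C D) : Prop :=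
  forall (X : Q) (c : C X), qid X <= shom D (F X c) (G X c).

(* Adjunction in the locally preordered 2-category Cat(Q): unit and counit;
   the triangle identities are vacuous. *)
Definition adjunction (C D : category Q) (F : functor C D) (G : functor D C) : Prop :=
  functor_le (functor_id C) (functor_comp G F) /\
  functor_le (functor_comp F G) (functor_id D).

Lemma adjunctionP (C D : category Q) (F : functor C D) (G : functor D C) :
  adjunction F G <->
  forall (X Y : Q) (c : C X) (d : D Y), shom D (F X c) d = shom C c (G Y d).
Proof.
  split.
  - intros [eta eps] X Y c d; apply le_antisym.
    + apply le_trans with (shom C (G X (F X c)) (G Y d)); [ apply fhom |].
      apply le_trans with (shom C c (G X (F X c)) ∘ shom C (G X (F X c)) (G Y d));
        [| apply scomp ].
      rewrite <- (qcomp_idl (shom C (G X (F X c)) (G Y d))) at 1.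
      apply qcomp_monol, eta.
    + apply le_trans with (shom D (F X c) (F Y (G Y d))); [ apply fhom |].
      apply le_trans with (shom D (F X c) (F Y (G Y d)) ∘ shom D (F Y (G Y d)) d);
        [| apply scomp ].
      rewrite <- (qcomp_idr (shom D (F X c) (F Y (G Y d)))) at 1.
      apply qcomp_monor, eps.
  - intros H; split.
    + intros X c; simpl; rewrite <- H; apply cunit.
    + intros X d; simpl; rewrite H; apply cunit.
Qed.

(* [full_subcategory P X] is [{c : C X | P X c}]. *)
Definition full_subcategory (C : category Q) (P : forall X : Q, C X -> Prop) :
  category Q :=
  {| csemi :=
       {| sob := fun X => {c : C X | P X c};
          shom := fun X' X c' c => shom C (proj1_sig c') (proj1_sig c);
          scomp := fun X'' X' X c'' c' c =>
            scomp (proj1_sig c'') (proj1_sig c') (proj1_sig c) |};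
     cunit := fun X c => cunit (proj1_sig c) |}.

End Functors.

Record presheaf (Q : quantaloid) (A : semicategory Q) (X : Q) := Presheaf {
  pval :> forall Y : Q, A Y -> qhom X Y;
  pact : forall (Y Y' : Q) (a : A Y) (a' : A Y'), shom A a a' ∘ pval a' <= pval a }.

Arguments pval {Q A X} p {Y} a.

Section Presheaves.
Context {Q : quantaloid} (A : semicategory Q).

Lemma presheaf_ext (X : Q) (phi psi : presheaf A X) :
  (forall (Y : Q) (a : A Y), phi Y a = psi Y a) -> phi = psi.
Proof.
  destruct phi as [f Hf], psi as [g Hg]; simpl; intros H.
  assert (E : f = g).
  { apply functional_extensionality_dep; intros Y.
    apply functional_extensionality; intros a; apply H. }
  subst g; f_equal; apply proof_irrelevance.
Qed.

(* Supremum and infimum of a family indexed by all the objects of [A]. *)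
Definition osup (L : complete_lattice) (F : forall Y : Q, A Y -> L) : L :=
  sup (fun u => exists (Y : Q) (a : A Y), u = F Y a).
Definition oinf (L : complete_lattice) (F : forall Y : Q, A Y -> L) : L :=
  inf (fun u => exists (Y : Q) (a : A Y), u = F Y a).

Lemma le_oinf (L : complete_lattice) (F : forall Y : Q, A Y -> L) (u : L) :
  u <= oinf F <-> forall (Y : Q) (a : A Y), u <= F Y a.
Proof.
  split.
  - intros H Y a; apply (le_trans H), inf_lower; now exists Y, a.
  - intros H; apply inf_greatest; intros v (Y & a & ->); apply H.
Qed.

Lemma osup_le (L : complete_lattice) (F : forall Y : Q, A Y -> L) (u : L) :
  osup F <= u <-> forall (Y : Q) (a : A Y), F Y a <= u.
Proof.
  split.
  - intros H Y a; refine (le_trans _ H); apply sup_upper; now exists Y, a.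
  - intros H; apply sup_least; intros v (Y & a & ->); apply H.
Qed.

Lemma qcomp_osup (X Y Z : Q) (g : qhom Y Z) (F : forall W : Q, A W -> qhom X Y) :
  g ∘ osup F = osup (fun W a => g ∘ F W a).
Proof.
  unfold osup at 1; rewrite qcomp_supr; apply le_antisym.
  - apply sup_least; intros u [f (W & a & ->) ->]; apply sup_upper; now exists W, a.
  - apply osup_le; intros W a; apply sup_upper.
    exists (F W a); [ now exists W, a | reflexivity ].
Qed.

Definition PA_hom (Y X : Q) (psi : presheaf A Y) (phi : presheaf A X) : qhom X Y :=
  oinf (fun Z a => lifting (psi Z a) (phi Z a)).

Lemma PA_homP (Y X : Q) (psi : presheaf A Y) (phi : presheaf A X) (h : qhom X Y) :
  h <= PA_hom psi phi <-> forall (Z : Q) (a : A Z), psi Z a ∘ h <= phi Z a.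
Proof.
  unfold PA_hom; rewrite le_oinf.
  split; intros H Z a; apply liftingP, H.
Qed.

Lemma PA_comp (Z Y X : Q) (chi : presheaf A Z) (psi : presheaf A Y) (phi : presheaf A X) :
  PA_hom chi psi ∘ PA_hom psi phi <= PA_hom chi phi.
Proof.
  apply PA_homP; intros W a; rewrite qcompA.
  apply le_trans with (psi W a ∘ PA_hom psi phi).
  - apply qcomp_monol; revert W a; apply PA_homP, le_refl.
  - revert W a; apply PA_homP, le_refl.
Qed.

Lemma PA_unit (X : Q) (phi : presheaf A X) : qid X <= PA_hom phi phi.
Proof. apply PA_homP; intros W a; rewrite qcomp_idr; apply le_refl. Qed.

Definition PA : category Q :=
  {| csemi := {| sob := presheaf A; shom := PA_hom; scomp := PA_comp |};
     cunit := PA_unit |}.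

Definition representable (X : Q) (a : A X) : presheaf A X :=
  {| pval := fun Y x => shom A x a;
     pact := fun Y Y' x x' => scomp x x' a |}.

Lemma tensor_act (X : Q) (phi : presheaf A X) (Y Y' : Q) (a : A Y) (a' : A Y') :
  shom A a a' ∘ osup (fun Z x => shom A a' x ∘ phi Z x)
    <= osup (fun Z x => shom A a x ∘ phi Z x).
Proof.
  rewrite qcomp_osup; apply osup_le; intros Z x; rewrite qcompA.
  apply le_trans with (shom A a x ∘ phi Z x); [ apply qcomp_monol, scomp |].
  apply sup_upper; now exists Z, x.
Qed.

Definition tensor (X : Q) (phi : presheaf A X) : presheaf A X :=
  {| pval := fun Y a => osup (fun Z x => shom A a x ∘ phi Z x);
     pact := tensor_act phi |}.

Lemma cotensor_act (X : Q) (phi : presheaf A X) (Y Y' : Q) (a : A Y) (a' : A Y') :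
  shom A a a' ∘ oinf (fun Z x => lifting (shom A x a') (phi Z x))
    <= oinf (fun Z x => lifting (shom A x a) (phi Z x)).
Proof.
  apply le_oinf; intros Z x; apply liftingP; rewrite qcompA.
  apply le_trans with
    (shom A x a' ∘ oinf (fun Z x => lifting (shom A x a') (phi Z x)));
    [ apply qcomp_monol, scomp |].
  apply liftingP; revert Z x; apply le_oinf, le_refl.
Qed.

(* The presheaf [A, phi]. *)
Definition cotensor (X : Q) (phi : presheaf A X) : presheaf A X :=
  {| pval := fun Y a => oinf (fun Z x => lifting (shom A x a) (phi Z x));
     pact := cotensor_act phi |}.

Lemma cotensorE (X Y : Q) (phi : presheaf A X) (a : A Y) :
  cotensor phi Y a = PA_hom (representable a) phi.
Proof. reflexivity. Qed.

Definition regular_presheaf (X : Q) (phi : presheaf A X) : Prop := phi = tensor phi.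

Definition yoneda_presheaf (X : Q) (phi : presheaf A X) : Prop := phi = cotensor phi.

Definition RA : category Q := full_subcategory (C := PA) regular_presheaf.

Definition YA : category Q := full_subcategory (C := PA) yoneda_presheaf.

Definition regular_semicategory : Prop :=
  forall (X : Q) (a : A X), regular_presheaf (representable a).

End Presheaves.

(* Main.v *)
Require Import Defs.

(** For any semicategory [A], tensoring with [A] is left adjoint to cotensoring
    with [A] on the whole of [PA A] ([PA_hom_tensor_cotensor]): for [h : X -> Y],
    both hom-arrows bound [h] exactly when A(a, x) ∘ psi(x) ∘ h <= phi(a) for all
    [a] and [x].  Restricted on one side to regular presheaves, this is already
    [j ⊣ k].

    Regularity of [A] makes [A] idempotent for composition of distributors, so
    tensoring twice is tensoring once: every tensor is regular
    ([tensor_regular]).  Since tensor psi <= psi, it is a coreflection onto them: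
    arrows out of a regular presheaf do not distinguish [psi] from [tensor psi]
    ([PA_hom_tensorr]).  This is [i ⊣ j].

    Composing the two adjunctions yields [tensor_cotensor] and [cotensor_tensor]:
    in either composite the outer operation absorbs the inner one.  So [j ∘ k] is
    the identity, which makes [k] fully faithful, and [tensor] and [cotensor] restrict
    to mutually inverse bijections between regular and Yoneda presheaves, which
    identifies the image of [k]. *)

Section TensorCotensor.
Context {Q : quantaloid} {A : semicategory Q}.

Lemma tensor_le {X Y : Q} (phi : presheaf A X) (a : A Y) :
  tensor phi Y a <= phi Y a.
Proof. apply osup_le; intros Z x; apply pact. Qed.

Lemma le_tensor {X Y Z : Q} (phi : presheaf A X) (a : A Y) (x : A Z) :
  shom A a x ∘ phi Z x <= tensor phi Y a.
Proof. apply sup_upper; now exists Z, x. Qed.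

(** Composition preserves suprema in its left variable too: this is what lets an
    arrow [h] composed on the right with a tensor be tested termwise. *)
Lemma tensor_comp_le {X Y Z : Q} (psi : presheaf A Y) (a : A Z) (h : qhom X Y)
    (u : qhom X Z) :
  tensor psi Z a ∘ h <= u <->
  forall (W : Q) (x : A W), shom A a x ∘ (psi W x ∘ h) <= u.
Proof.
  split; intros H.
  - intros W x; rewrite qcompA.
    refine (le_trans _ H); apply qcomp_monol, le_tensor.
  - simpl; unfold osup; rewrite qcomp_supl.
    apply sup_least; intros v [g (W & x & ->) ->].
    rewrite <- qcompA; apply H.
Qed.

(** A presheaf is determined by the arrows into it, because [PA A] is skeletal:
    instantiating at either presheaf and its identity gives both inequalities. *)
Lemma PA_hom_inj {X : Q} (phi psi : presheaf A X) :
  (forall chi : presheaf A X, PA_hom chi phi = PA_hom chi psi) -> phi = psi.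
Proof.
  intros H; apply presheaf_ext; intros Y a; apply le_antisym.
  - rewrite <- (qcomp_idr (phi Y a)); revert Y a; apply PA_homP.
    rewrite <- H; apply PA_unit.
  - rewrite <- (qcomp_idr (psi Y a)); revert Y a; apply PA_homP.
    rewrite H; apply PA_unit.
Qed.

Lemma PA_hom_monor {X Y : Q} (psi : presheaf A Y) (phi phi' : presheaf A X) :
  (forall (Z : Q) (a : A Z), phi Z a <= phi' Z a) ->
  PA_hom psi phi <= PA_hom psi phi'.
Proof.
  intros H; apply PA_homP; intros Z a; refine (le_trans _ (H Z a)).
  revert Z a; apply PA_homP, le_refl.
Qed.

Lemma PA_hom_tensor_mono {X Y : Q} (psi : presheaf A Y) (phi : presheaf A X) :
  PA_hom psi phi <= PA_hom (tensor psi) (tensor phi).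
Proof.
  apply PA_homP; intros Z a; apply tensor_comp_le; intros W x.
  refine (le_trans _ (le_tensor phi a x)); apply qcomp_monor.
  revert W x; apply PA_homP, le_refl.
Qed.

(** Both hom-arrows bound [h] exactly when A(a, x) ∘ psi(x) ∘ h <= phi(a) for all
    [a] and [x]. *)
Lemma PA_hom_tensor_cotensor {X Y : Q} (psi : presheaf A Y) (phi : presheaf A X) :
  PA_hom (tensor psi) phi = PA_hom psi (cotensor phi).
Proof.
  apply le_antisym.
  - apply PA_homP; intros W x; apply le_oinf; intros Z a; apply liftingP.
    revert W x; apply tensor_comp_le; revert Z a; apply PA_homP, le_refl.
  - apply PA_homP; intros Z a; apply tensor_comp_le; intros W x; apply liftingP.
    revert Z a; apply (le_oinf (fun Z a => lifting (shom A a x) (phi Z a))).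
    revert W x; apply (PA_homP psi (cotensor phi)), le_refl.
Qed.

(** Arrows out of a regular presheaf cannot see the difference between a presheaf
    and its tensor: an arrow out of phi = tensor phi can itself be tensored. *)
Lemma PA_hom_tensorr {X Y : Q} (phi : presheaf A Y) (psi : presheaf A X) :
  regular_presheaf phi -> PA_hom phi (tensor psi) = PA_hom phi psi.
Proof.
  intros Hphi; apply le_antisym.
  - apply PA_hom_monor; intros Z a; apply tensor_le.
  - rewrite Hphi at 2; apply PA_hom_tensor_mono.
Qed.

Section Regular.
Context (hA : regular_semicategory A).

(** Regularity of [A] splits the factor A(a, x) in A(a, x) ∘ psi(x) as a supremum
    of composites A(a, y) ∘ A(y, x), whose terms lie below the iterated tensor. *)
Lemma tensor_regular {X : Q} (psi : presheaf A X) : regular_presheaf (tensor psi).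
Proof.
  apply presheaf_ext; intros Y a; apply le_antisym; [| apply tensor_le ].
  apply osup_le; intros Z x.
  change (shom A a x) with (representable x Y a); rewrite (hA _ x).
  apply tensor_comp_le; intros W y.
  refine (le_trans _ (le_tensor (tensor psi) a y)); apply qcomp_monor, le_tensor.
Qed.

(** Arrows chi -> cotensor (tensor phi) are arrows tensor chi -> tensor phi; as
    tensor chi is regular, these are the arrows tensor chi -> phi. *)
Lemma cotensor_tensor {X : Q} (phi : presheaf A X) :
  cotensor (tensor phi) = cotensor phi.
Proof.
  apply PA_hom_inj; intros chi; rewrite <- !PA_hom_tensor_cotensor.
  apply PA_hom_tensorr, tensor_regular.
Qed.

Lemma tensor_cotensor {X : Q} (phi : presheaf A X) :
  tensor (cotensor phi) = tensor phi.
Proof.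
  apply presheaf_ext; intros Y a; apply le_antisym.
  - rewrite <- (qcomp_idr (tensor (cotensor phi) Y a)); revert Y a; apply PA_homP.
    (* The source is regular, so it is enough to bound it by [phi]: this is the
       counit tensor (cotensor phi) <= phi, the transpose of an identity. *)
    rewrite PA_hom_tensorr, PA_hom_tensor_cotensor by apply tensor_regular.
    apply PA_unit.
  - rewrite <- (qcomp_idr (tensor phi Y a)); revert Y a; apply PA_homP.
    (* The tensor of phi <= cotensor phi, itself the transpose of
       tensor phi <= phi. *)
    refine (le_trans _ (PA_hom_tensor_mono _ _)).
    rewrite <- PA_hom_tensor_cotensor.
    apply PA_homP; intros Z x; rewrite qcomp_idr; apply tensor_le.
Qed.

(** By adjunction, arrows between cotensors are arrows out of
    tensor (cotensor phi), which is [phi] itself when [phi] is regular. *)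
Lemma PA_hom_cotensor {X Y : Q} (phi : presheaf A Y) (psi : presheaf A X) :
  regular_presheaf phi -> PA_hom phi psi = PA_hom (cotensor phi) (cotensor psi).
Proof.
  intros Hphi.
  now rewrite <- PA_hom_tensor_cotensor, tensor_cotensor, <- Hphi.
Qed.

Lemma cotensor_yoneda {X : Q} (phi : presheaf A X) : yoneda_presheaf (cotensor phi).
Proof.
  unfold yoneda_presheaf.
  now rewrite <- (cotensor_tensor (cotensor phi)), tensor_cotensor, cotensor_tensor.
Qed.

Definition RA_inclusion : functor (RA A) (PA A) :=
  {| fob := fun X (phi : RA A X) => proj1_sig phi : PA A X;
     fhom := fun Y X (psi : RA A Y) (phi : RA A X) =>
       le_refl (PA_hom (proj1_sig psi) (proj1_sig phi)) |}.

Definition tensor_functor : functor (PA A) (RA A) :=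
  {| fob := fun X (psi : PA A X) =>
       exist _ (tensor psi) (tensor_regular psi) : RA A X;
     fhom := fun Y X (psi : PA A Y) (phi : PA A X) => PA_hom_tensor_mono psi phi |}.

Lemma cotensor_fhom {Y X : Q} (psi : RA A Y) (phi : RA A X) :
  shom (RA A) psi phi <=
  shom (PA A) (cotensor (proj1_sig psi)) (cotensor (proj1_sig phi)).
Proof.
  simpl; rewrite <- PA_hom_cotensor by exact (proj2_sig psi); apply le_refl.
Qed.

Definition cotensor_functor : functor (RA A) (PA A) :=
  {| fob := fun X (theta : RA A X) => cotensor (proj1_sig theta) : PA A X;
     fhom := @cotensor_fhom |}.

End Regular.
End TensorCotensor.

Theorem theorem3p12 (Q : quantaloid) (A : semicategory Q)
  (hA : regular_semicategory A) :
  exists (i : functor (RA A) (PA A)) (j : functor (PA A) (RA A))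
         (k : functor (RA A) (PA A)),
    (forall (X : Q) (phi : RA A X), i X phi = proj1_sig phi) /\
    (forall (X : Q) (psi : PA A X), proj1_sig (j X psi) = tensor psi) /\
    (forall (X : Q) (theta : RA A X), k X theta = cotensor (proj1_sig theta)) /\
    adjunction i j /\
    adjunction j k /\
    fully_faithful i /\
    fully_faithful k /\
    (forall (X : Q) (phi : PA A X),
       (exists theta : RA A X, k X theta = phi) <->
       (exists upsilon : YA A X, proj1_sig upsilon = phi)).
Proof.
  exists RA_inclusion, (tensor_functor hA), (cotensor_functor hA).
  do 3 (split; [ now intros |]); split; [| split; [| split; [| split ]]].
  - apply adjunctionP; intros X Y phi psi; symmetry.
    apply PA_hom_tensorr, (proj2_sig phi).
  - apply adjunctionP; intros X Y psi theta; apply PA_hom_tensor_cotensor.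
  - now intros X' X psi phi.
  - intros X' X psi phi; apply (PA_hom_cotensor hA), (proj2_sig psi).
  - intros X phi; split.
    + intros [theta <-].
      now exists (exist _ (cotensor (proj1_sig theta)) (cotensor_yoneda hA _)).
    + intros [[psi Hpsi] <-].
      exists (exist _ (tensor psi) (tensor_regular hA psi)); simpl.
      now rewrite (cotensor_tensor hA).
Qed.
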